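(* Let $U=SC$ be the quantum walk on the half line with coins $C_j$ determined by parameters $\eta_j\in\mathbb{C}$ with $|\eta_j|\le 1$ and $\mathrm{Im}(\eta_j)=\kappa$ for all $j\ge 0$, let $\phi=\arccos\kappa\in[0,\pi]$, and let $\mathcal{H}_+=\ker(1-S)\cap\ker K^*\subset \ell^2(A)$. Then the underlying birth and death process is transient if and only if $\mathcal{H}_+\neq \{0\}$. The eigenspace is described by $$\mathcal{H}_+=\ker(-ie^{-i\phi}-U)=\mathbb{C}\,\xi_*,$$ where $\xi_*(0;L)=1$ and $$\xi_*(j;R)=\xi_*(j+1;L)=(-1)^{j+1}\sqrt{\frac{q_0\cdots q_j}{p_0\cdots p_j}}\qquad(j\ge 0).$$
   Context: Graph: the half line with vertex set $\mathbb{Z}_+=\{0,1,2,\dots\}$, edges $\{j,j+1\}$, and one self loop at $0$. The arc set $A$ consists of, for each $j\ge 0$, the arc $(j;R)$ with terminus $j$ and origin $j+1$, the arc $(j+1;L)$ with terminus $j+1$ and origin $j$, and the self loop $(0;L)$. Inverse arcs: $\overline{(j;R)}=(j+1;L)$, $\overline{(j+1;L)}=(j;R)$, $\overline{(0;L)}=(0;L)$. The flip-flop shift on $\ell^2(A)$ is $(S\psi)(a)=\psi(\bar a)$. Coin: $C=\bigoplus_{j\ge0}C_j$, where $C_j$ acts on functions supported on the two arcs with terminus $j$; in the ordered basis $((j;R),(j;L))$, $$C_j=\begin{bmatrix}-\eta_j&\rho_j\\ \rho_j&\bar\eta_j\end{bmatrix},\qquad \rho_j=\sqrt{1-|\eta_j|^2}.$$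 It is assumed that $\mathrm{Im}(\eta_j)=\kappa$ is independent of $j$, and that the coins have two distinct eigenvalues (so $\kappa\ne\pm1$). Then $\mathrm{Spec}(C_j)=\{-ie^{\pm i\phi}\}$ with $\cos\phi=\kappa$, $e^{i\phi}=\kappa+i\sqrt{1-\kappa^2}$, and $\ker(C_j+ie^{i\phi})=\mathbb{C}\,[\sqrt{p_j}\ \sqrt{q_j}]^\top$, where $$p_j=\tfrac12\Bigl(1-\tfrac{\mathrm{Re}(\eta_j)}{\sqrt{1-\kappa^2}}\Bigr),\qquad q_j=\tfrac12\Bigl(1+\tfrac{\mathrm{Re}(\eta_j)}{\sqrt{1-\kappa^2}}\Bigr).$$ The quantum walk is $U=SC$ on $\ell^2(A)$. Underlying birth and death process: the Markov chain on $\mathbb{Z}_+$ that from $j\ge1$ moves to $j+1$ with probability $p_j$ and to $j-1$ with probability $q_j$, and from $0$ moves to $1$ with probability $p_0$ and stays at $0$ with probability $q_0$. It is transient if the probability of ever returning to the starting state is less than $1$. The map $K:\ell^2(\mathbb{Z}_+)\to\ell^2(A)$ is $(Kf)(j;R)=\sqrt{p_j}f(j)$, $(Kf)(j;L)=\sqrt{q_j}f(j)$; its adjoint is $(K^*\psi)(j)=\sqrt{p_j}\,\psi(j;R)+\sqrt{q_j}\,\psi(j;L)$.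
   Formalization: The formal statement assumes p_j > 0 and q_j > 0 for all j (so |η_j| < 1); with q_0 = 0 and p_j = q_j = 1/2 for j ≥ 1 the equivalence fails. H_+ = ℂξ_* is stated only when H_+ ≠ {0}, since otherwise ξ_* is not in ℓ²(A). *)

(* Defs.v *)
From HB Require Import structures.
From mathcomp Require Import all_boot all_order all_algebra.
From mathcomp Require Import all_classical all_reals all_analysis.
From mathcomp Require Export complex.

Set Implicit Arguments.
Unset Strict Implicit.
Unset Printing Implicit Defensive.

Import Order.TTheory GRing.Theory Num.Theory.
Local Open Scope classical_set_scope.
Local Open Scope complex_scope.
Local Open Scope ring_scope.

(** [arcR j] is the arc (j;R) and [arcL j] the arc (j;L); both have terminus
    [j].  [arcL 0] is the self loop at [0]. *)
Inductive arc := arcR of nat | arcL of nat.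

Definition arc_code (a : arc) : nat + nat :=
  match a with arcR j => inl j | arcL j => inr j end.
Definition arc_decode (s : nat + nat) : arc :=
  match s with inl j => arcR j | inr j => arcL j end.
Lemma arc_codeK : cancel arc_code arc_decode. Proof. by case. Qed.
HB.instance Definition _ := Countable.copy arc (can_type arc_codeK).

Definition arc_inv (a : arc) : arc :=
  match a with
  | arcR j => arcL j.+1
  | arcL 0 => arcL 0
  | arcL j.+1 => arcR j
  end.

Section QuantumWalk.
Variable R : realType.
Implicit Types (eta : nat -> R[i]) (kappa : R) (psi : arc -> R[i]).

Definition l2 psi : Prop :=
  summable [set: arc] (fun a => (complex.Re `|psi a| ^+ 2)%:E).

(** Kernel, inside l^2(A), of an operator given on all functions on arcs. *)
Definition ker_l2 (V : zmodType) (T : (arc -> R[i]) -> V) : set (arc -> R[i]) :=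
  [set psi | l2 psi /\ T psi = 0].

Definition shift psi : arc -> R[i] := fun a => psi (arc_inv a).

Definition rho eta (j : nat) : R := Num.sqrt (1 - complex.Re `|eta j| ^+ 2).

Definition coin eta psi : arc -> R[i] := fun a =>
  match a with
  | arcR j => - eta j * psi (arcR j) + (rho eta j)%:C * psi (arcL j)
  | arcL j => (rho eta j)%:C * psi (arcR j) + ((eta j)^*)%C * psi (arcL j)
  end.

Definition walk eta psi : arc -> R[i] := shift (coin eta psi).

Definition pr eta kappa (j : nat) : R :=
  2^-1 * (1 - complex.Re (eta j) / Num.sqrt (1 - kappa ^+ 2)).
Definition qr eta kappa (j : nat) : R :=
  2^-1 * (1 + complex.Re (eta j) / Num.sqrt (1 - kappa ^+ 2)).

(** The adjoint of [K : l^2(Z_+) -> l^2(A)],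
    [(K f)(j;R) = sqrt p_j * f j], [(K f)(j;L) = sqrt q_j * f j]. *)
Definition Kadj eta kappa psi : nat -> R[i] := fun j =>
  (Num.sqrt (pr eta kappa j))%:C * psi (arcR j)
  + (Num.sqrt (qr eta kappa j))%:C * psi (arcL j).

Definition Hplus eta kappa : set (arc -> R[i]) :=
  ker_l2 (fun psi => psi - shift psi) `&` ker_l2 (Kadj eta kappa).

Definition expi (t : R) : R[i] := cos t +i* sin t.

Definition xi_R eta kappa (j : nat) : R[i] :=
  (-1) ^+ j.+1 * (Num.sqrt ((\prod_(k < j.+1) qr eta kappa k)
                            / (\prod_(k < j.+1) pr eta kappa k)))%:C.

Definition xi eta kappa : arc -> R[i] := fun a =>
  match a with
  | arcR j => xi_R eta kappa j
  | arcL 0 => 1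
  | arcL j.+1 => xi_R eta kappa j
  end.

(** As [0.-1 = 0], the second branch also covers the loop at [0], of
    probability [q 0]. *)
Definition bd_trans (p q : nat -> R) (x y : nat) : R :=
  if y == x.+1 then p x else if y == x.-1 then q x else 0.

(** [X] is a Markov chain on nat started at [i] with transition matrix
    [bd_trans p q], characterised by its finite-dimensional laws. *)
Definition bd_chain (p q : nat -> R) (i : nat) (d : measure_display)
    (Omega : measurableType d) (P : probability Omega R)
    (X : nat -> {RV P >-> nat}) : Prop :=
  P [set w | X 0%N w = i] = 1%E /\
  forall (n : nat) (x : nat -> nat),
    P [set w | forall k : nat, (k <= n.+1)%N -> X k w = x k] =
    (P [set w | forall k : nat, (k <= n)%N -> X k w = x k]
     * (bd_trans p q (x n) (x n.+1))%:E)%E.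

Definition transient_chain (d : measure_display) (Omega : measurableType d)
    (P : probability Omega R) (X : nat -> {RV P >-> nat}) : Prop :=
  (P [set w | exists n : nat, (0 < n)%N /\ X n w = X 0%N w] < 1)%E.

End QuantumWalk.

(* Main.v *)
Require Import Defs.
From HB Require Import structures.
From mathcomp Require Import all_boot all_order all_algebra.
From mathcomp Require Import all_classical all_reals all_analysis.
From mathcomp Require Import complex ring lra zify.

(** The coin at [j] is [lambda + 2 sin phi * K_j K_j^*] with
    [lambda = - i e^{- i phi}].  Solving [S C psi = lambda psi] outwards from the
    self loop gives [K^* psi = 0] one vertex at a time, with no use of square
    summability; then [S psi = psi] too, and these two recursions leave only the
    multiples of [xi].  Hence [H_+ <> 0] iff [xi] is square summable, i.e. iff
    the series of the ratios [q_0 ... q_j / (p_0 ... p_j)] converges.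

    That is also the transience criterion.  The probability of avoiding [i] for
    ever is harmonic off [i], vanishes on [0, i], and increases beyond [i]
    proportionally to the ratios; being at most [1], it is nonzero only if the
    series converges.  Conversely the normalised partial sums of a convergent
    series are a subharmonic minorant of all the finite-time avoidance
    probabilities. *)

Set Implicit Arguments.
Unset Strict Implicit.
Unset Printing Implicit Defensive.

Import Order.TTheory GRing.Theory Num.Theory.
Import numFieldNormedType.Exports.
Local Open Scope classical_set_scope.
Local Open Scope complex_scope.
Local Open Scope ring_scope.

(** * Avoidance probabilities and harmonic functions of the birth and death process *)

Section BirthDeath.
Context {R : realType}.
Variables (p q : nat -> R).
Hypotheses (p_gt0 : forall x, 0 < p x) (q_gt0 : forall x, 0 < q x).
Hypothesis pqD : forall x, p x + q x = 1.

Definition ratio (j : nat) : R :=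
  (\prod_(k < j.+1) q k) / (\prod_(k < j.+1) p k).

Lemma ratio_gt0 j : 0 < ratio j.
Proof. by apply: divr_gt0; apply: prodr_gt0. Qed.

Lemma ratio_ge0 j : 0 <= ratio j.
Proof. exact/ltW/ratio_gt0. Qed.

(** This recursion governs both the increments of a harmonic function and the squared moduli of a
    shift-invariant element of the kernel of [Kadj], which ties the two halves together. *)
Lemma ratioS j : p j.+1 * ratio j.+1 = q j.+1 * ratio j.
Proof.
rewrite /ratio (big_ord_recr j.+1)/= (big_ord_recr j.+1)/=.
have P_neq0 : \prod_(k < j.+1) p k != 0 by rewrite gt_eqF//; apply: prodr_gt0.
have p_neq0 : p j.+1 != 0 by rewrite gt_eqF.
field.
by rewrite P_neq0 p_neq0.
Qed.

Variable i : nat.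

(** [avoid n x] is the probability that the chain started at [x] is not at [i]
    at any of the times [1, ..., n]. *)
Fixpoint avoid (n x : nat) : R :=
  if n is m.+1 then
    p x * (if x.+1 == i then 0 else avoid m x.+1)
    + q x * (if x.-1 == i then 0 else avoid m x.-1)
  else 1.

(** The same with the time [0] included. *)
Definition avoid_start n x : R := if x == i then 0 else avoid n x.

Lemma avoid_ge0 n x : 0 <= avoid n x.
Proof.
elim: n x => [|n IHn] x //=.
by apply: addr_ge0; apply: mulr_ge0; rewrite ?(ltW (p_gt0 _)) ?(ltW (q_gt0 _))//;
  case: ifP.
Qed.

Lemma avoidS_le n x : avoid n.+1 x <= avoid n x.
Proof.
elim: n x => [|n IHn] x.
  rewrite -[leRHS](pqD x) /=.
  have le1 b : (if b then 0 else 1) <= 1 :> R by case: b.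
  by apply: lerD; apply: ler_piMr => //; exact: ltW.
rewrite [leLHS]/= [leRHS]/=.
by apply: lerD; apply: ler_wpM2l; rewrite ?(ltW (p_gt0 _)) ?(ltW (q_gt0 _))//;
  case: ifP => // _; exact: IHn.
Qed.

Lemma avoid_nonincreasing x : nonincreasing_seq (avoid ^~ x).
Proof. by apply/nonincreasing_seqP => n; exact: avoidS_le. Qed.

Lemma avoid_le1 n x : avoid n x <= 1.
Proof. exact: (avoid_nonincreasing x (leq0n n)). Qed.

(** The probability that the chain started at [x] never visits [i], time 0 included. *)
Definition escape x : R := limn (avoid_start ^~ x).

Lemma avoid_start_cvg x : avoid_start ^~ x @ \oo --> escape x.
Proof.
apply: nonincreasing_is_cvgn.
  by move=> m n mn; rewrite /avoid_start; case: ifP => // _;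
    exact: avoid_nonincreasing.
by exists 0 => _ [n _ <-]; rewrite /avoid_start; case: ifP => // _; exact: avoid_ge0.
Qed.

Lemma avoid_cvg x : avoid ^~ x @ \oo --> p x * escape x.+1 + q x * escape x.-1.
Proof.
(* Shifting the index exposes the recursion of [avoid], whose two terms are values of
   [avoid_start]. *)
rewrite -cvg_shiftS /=.
by apply: cvgD; apply: cvgMr; exact: avoid_start_cvg.
Qed.

Lemma escape_start : escape i = 0.
Proof. by apply/cvg_lim => //; rewrite /avoid_start eqxx; exact: cvg_cst. Qed.

Lemma escape_le1 x : escape x <= 1.
Proof.
apply: limr_le; first exact: avoid_start_cvg.
by apply: nearW => n; rewrite /avoid_start; case: ifP => // _; exact: avoid_le1.
Qed.

Lemma escape_harmonic x : x != i -> escape x = p x * escape x.+1 + q x * escape x.-1.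
Proof.
move=> /negbTE xi; apply/cvg_lim => //.
by rewrite /avoid_start xi; exact: avoid_cvg.
Qed.

(** When [0 < i], the loop turns harmonicity at 0 into [escape 1 = escape 0]; equality of neighbours
    then propagates up to [i], where the value is 0. *)
Lemma escape_left x : (x <= i)%N -> escape x = 0.
Proof.
have step y : (y < i)%N -> escape y.+1 = escape y.
  elim: y => [|y IHy] yi.
    have := escape_harmonic (negbT (ltn_eqF yi)); rewrite /=.
    have := pqD 0; have := p_gt0 0; nra.
  have := escape_harmonic (negbT (ltn_eqF yi)); rewrite /= -(IHy (ltnW yi)).
  have := pqD y.+1; have := p_gt0 y.+1; nra.
move=> xi; rewrite -escape_start -(subnKC xi).
have : (x + (i - x) <= i)%N by rewrite subnKC.
elim: (i - x)%N => [|k IHk]; first by rewrite addn0.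
by rewrite addnS => lt; rewrite step// IHk// ltnW.
Qed.

(** Harmonicity and [p + q = 1] say that [p] times the next increment is [q] times the previous one,
    as in [ratioS]. The first increment is [escape i.+1], since [escape i = 0]. *)
Lemma escape_step m :
  ratio i * (escape (i + m).+1 - escape (i + m)%N) = escape i.+1 * ratio (i + m).
Proof.
elim: m => [|m IHm]; first by rewrite addn0 escape_start subr0 mulrC.
rewrite addnS.
have /escape_harmonic /= h : (i + m).+1 != i by lia.
have hr := ratioS (i + m); have hpq := pqD (i + m).+1.
have p0 : p (i + m).+1 != 0 by rewrite gt_eqF.
apply: (mulfI p0); rewrite mulrCA [RHS]mulrCA hr [RHS]mulrCA -IHm [RHS]mulrCA.
congr (_ * _); move: h hpq.
set a := escape _.+2; set b := escape _.+1; set c := escape _.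
set P := p _; set Q := q _ => h hpq.
apply/eqP; rewrite -subr_eq0.
have -> : P * (a - b) - Q * (b - c) = (P * a + Q * c) - (P + Q) * b by ring.
by rewrite -h hpq mul1r subrr.
Qed.

Lemma escape_sum m :
  ratio i * escape (i + m)%N = escape i.+1 * \sum_(i <= k < i + m) ratio k.
Proof.
elim: m => [|m IHm]; first by rewrite addn0 escape_start big_geq// !mulr0.
rewrite addnS big_nat_recr ?leq_addr//= mulrDr -IHm -escape_step; ring.
Qed.

(** The bound is [p i * h i.+1] for the minorant [h] below: the first step goes right, and from
    there avoidance is at least [h]. *)
Lemma avoid_lower S n :
  (forall m, \sum_(k < m) ratio k <= S) -> p i * ratio i / S <= avoid n i.
Proof.
move=> ubS.
have S_gt0 : 0 < S.
  by rewrite (lt_le_trans _ (ubS 1%N))// big_ord1 ratio_gt0.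
pose h x : R := (\sum_(i <= k < x) ratio k) / S.
have h_ge0 x : 0 <= h x.
  by apply: divr_ge0; rewrite ?(ltW S_gt0)// sumr_ge0// => k _; exact: ratio_ge0.
have h_le1 x : h x <= 1.
  rewrite ler_pdivrMr// mul1r (le_trans _ (ubS x))//.
  have [xi|xi] := leqP x i.
    by rewrite big_geq// sumr_ge0// => k _; exact: ratio_ge0.
  rewrite -(big_mkord xpredT) [leRHS](big_cat_nat (n := i))//=; last exact: ltnW.
  by rewrite lerDr sumr_ge0// => k _; exact: ratio_ge0.
have h_i : h i = 0 by rewrite /h big_geq// mul0r.
(* Below [i] the left side is 0; beyond [i] equality holds by [ratioS]. *)
have h_sub x : x != i -> h x <= p x * h x.+1 + q x * h x.-1.
  move=> xi; have [{}xi|{}xi] := leqP x i.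
    by rewrite {1}/h big_geq// mul0r addr_ge0// mulr_ge0// ltW.
  case: x xi => // x xi /=.
  have hS y : (i <= y)%N -> h y.+1 = h y + ratio y / S.
    by move=> iy; rewrite /h big_nat_recr//= mulrDl.
  rewrite (hS x.+1) 1?ltnW// (hS x)// -{1}[h x + _]mul1r -(pqD x.+1).
  have := ratioS x; set r := ratio _; set r' := ratio _ => e.
  suff -> : p x.+1 * (h x + r' / S + r / S) + q x.+1 * h x =
     (p x.+1 + q x.+1) * (h x + r' / S) by [].
  have -> : p x.+1 * (h x + r' / S + r / S) =
    p x.+1 * (h x + r' / S) + (p x.+1 * r) / S by ring.
  by rewrite e; ring.
have le_avoid m x : h x <= avoid_start m x.
  elim: m x => [|m IHm] x; rewrite /avoid_start; case: eqVneq => [->|xi];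
    rewrite ?h_i//.
  rewrite (le_trans (h_sub _ xi))//=.
  by apply: lerD; apply: ler_wpM2l; [exact: ltW | exact: IHm |
    exact: ltW | exact: IHm].
(* [avoid 0] is the constant 1, not a first-step sum; there the bound amounts to
   [p i * ratio i <= ratio i <= S]. *)
case: n => [|n]; last first.
  rewrite /= -[leLHS]addr0; apply: lerD.
    rewrite -mulrA; apply: ler_wpM2l; first exact: ltW.
    rewrite (le_trans _ (le_avoid n i.+1))// /h big_nat1//.
  by apply: mulr_ge0; [exact: ltW | case: ifP => // _; exact: avoid_ge0].
rewrite /= ler_pdivrMr// mul1r.
rewrite (le_trans _ (ubS i.+1))// big_ord_recr/= -[leLHS]add0r lerD//.
  by apply: sumr_ge0 => k _; exact: ratio_ge0.
rewrite ler_piMl ?ratio_ge0// -(pqD i) lerDl ltW//.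
Qed.

Lemma avoid_lim_gt0P l : avoid ^~ i @ \oo --> l ->
  0 < l <-> exists S, forall m, \sum_(k < m) ratio k <= S.
Proof.
move=> al; split=> [l_gt0|[S ubS]]; last first.
  have S_gt0 : 0 < S.
    by rewrite (lt_le_trans _ (ubS 1%N))// big_ord1 ratio_gt0.
  apply: (@lt_le_trans _ _ (p i * ratio i / S)).
    by rewrite divr_gt0// mulr_gt0// ratio_gt0.
  rewrite -(cvg_lim _ al)//; apply: limr_ge; first exact: cvgP al.
  by apply: nearW => n; exact: avoid_lower.
have lE : l = p i * escape i.+1.
  rewrite -(cvg_lim _ al)// (cvg_lim _ (avoid_cvg (x := i)))//.
  by rewrite (@escape_left i.-1) ?leq_pred// mulr0 addr0.
have escape_gt0 : 0 < escape i.+1 by move: l_gt0; rewrite lE pmulr_rgt0.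
(* As [escape <= 1], [escape_sum] bounds the sum from [i] on by the second term; the first covers
   the indices below [i]. *)
exists (\sum_(k < i) ratio k + ratio i / escape i.+1) => m.
apply: (@le_trans _ _ (\sum_(k < i + m) ratio k)).
  rewrite -!(big_mkord xpredT)
    (big_cat_nat (n := m) (p := (i + m)%N))//= ?leq_addl//.
  by rewrite lerDl sumr_ge0// => k _; exact: ratio_ge0.
rewrite -!(big_mkord xpredT) (big_cat_nat (n := i) (p := (i + m)%N))//= ?leq_addr//.
rewrite lerD2l ler_pdivlMr// mulrC -escape_sum.
by rewrite ler_piMr ?ratio_ge0// escape_le1.
Qed.

End BirthDeath.

(** * Cylinder events of the Markov chain and the probability of no return *)

Section Chain.
Context {R : realType}.
Variables (p q : nat -> R).
Hypotheses (p_gt0 : forall x, 0 < p x) (q_gt0 : forall x, 0 < q x).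
Hypothesis pqD : forall x, p x + q x = 1.
Variables (i : nat) (d : measure_display) (Omega : measurableType d).
Variables (P : probability Omega R) (X : nat -> {RV P >-> nat}).
Hypothesis X_chain : bd_chain p q i X.

Definition cyl (m : nat) (x : nat -> nat) : set Omega :=
  [set w | forall k : nat, (k <= m)%N -> X k w = x k].

Definition miss (m n : nat) : set Omega :=
  [set w | forall k : nat, (m < k <= m + n)%N -> X k w <> i].

Lemma probU (A B : set Omega) : measurable A -> measurable B ->
  A `&` B = set0 -> P (A `|` B) = (P A + P B)%E.
Proof. exact: measureU. Qed.

Lemma probD_eq0 (A B : set Omega) : measurable A -> measurable B ->
  B `<=` A -> P B = P A -> P (A `\` B) = 0%E.
Proof.
move=> mA mB BA PBA; rewrite measureD//; last by rewrite ltey_eq fin_num_measure.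
by rewrite (setIidr BA); move: PBA => /= ->; rewrite subee// fin_num_measure.
Qed.

Lemma measurable_eq k y : measurable [set w | X k w = y].
Proof. exact: (measurable_funPTI (X k) (Y := [set y])). Qed.

Lemma measurable_cyl m x : measurable (cyl m x).
Proof.
have -> : cyl m x = \bigcap_(k in [set k | (k <= m)%N]) [set w | X k w = x k].
  by apply/seteqP; split=> w /= h k hk; exact: h.
by apply: bigcap_measurableType => // k _; exact: measurable_eq.
Qed.

Lemma measurable_miss m n : measurable (miss m n).
Proof.
have -> : miss m n =
    \bigcap_(k in [set k | (m < k <= m + n)%N]) ~` [set w | X k w = i].
  by apply/seteqP; split=> w /= h k hk; exact: h.
by apply: bigcap_measurableType => // k _; apply: measurableC; exact: measurable_eq.
Qed.

(** Prolongs the path [x] by one step to [y]; later values are immaterial, as [cyl m.+1] stops at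
    time [m.+1]. *)
Definition upd (m : nat) (x : nat -> nat) (y : nat) : nat -> nat :=
  fun k => if k == m.+1 then y else x k.

Lemma cyl_upd m x y : cyl m.+1 (upd m x y) = cyl m x `&` [set w | X m.+1 w = y].
Proof.
apply/seteqP; split=> [w h|w [h hy] k].
  split=> [k km|]; last by have := h m.+1 (leqnn _); rewrite /upd eqxx.
  by have := h k (leqW km); rewrite /upd ltn_eqF.
rewrite /upd; case: eqVneq => [->//|km1 km]; apply: h.
by rewrite leq_eqVlt (negbTE km1) in km.
Qed.

Lemma prob_cyl_upd m x y :
  P (cyl m.+1 (upd m x y)) = (P (cyl m x) * (bd_trans p q (x m) y)%:E)%E.
Proof.
rewrite [LHS](X_chain.2 m (upd m x y)) /upd eqxx (ltn_eqF (ltnSn m)).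
congr (P _ * _)%E; apply/seteqP; split=> w h k km.
  by have := h k km; rewrite ltn_eqF.
by rewrite ltn_eqF//; exact: h.
Qed.

Lemma bd_transR x : bd_trans p q x x.+1 = p x.
Proof. by rewrite /bd_trans eqxx. Qed.

Lemma bd_transL x : bd_trans p q x x.-1 = q x.
Proof. by rewrite /bd_trans eqxx (_ : (_ == _) = false)//; lia. Qed.

(** The two possible steps from [x m] exhaust the probability of [cyl m x],
    since [p + q = 1]; every other step is negligible. *)
Lemma split_step m x (A : set Omega) : measurable A ->
  P (cyl m x `&` A) =
  (P (cyl m.+1 (upd m x (x m).+1) `&` A) + P (cyl m.+1 (upd m x (x m).-1) `&` A))%E.
Proof.
move=> mA; set R' := cyl _ (upd m x (x m).+1); set L := cyl _ (upd m x (x m).-1).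
have mC := measurable_cyl m x.
have mR : measurable R' by exact: measurable_cyl.
have mL : measurable L by exact: measurable_cyl.
have RL : R' `&` L = set0.
  apply/seteqP; split=> w //=; rewrite /R' /L !cyl_upd => -[[_ /= ->] [_ /=]]; lia.
have PRL : P (R' `|` L) = P (cyl m x).
  rewrite probU// /R' /L !prob_cyl_upd bd_transR bd_transL -ge0_muleDr.
  - by rewrite -EFinD pqD mule1.
  - by rewrite lee_fin ltW.
  - by rewrite lee_fin ltW.
have RLC : R' `|` L `<=` cyl m x.
  by rewrite /R' /L !cyl_upd => w [|] [].
have null : P (cyl m x `\` (R' `|` L)) = 0%E.
  by apply: probD_eq0 => //; exact: measurableU.
rewrite -probU; [| exact: measurableI | exact: measurableI |]; last first.
  by rewrite setIACA RL set0I.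
rewrite -setIUl.
have -> : cyl m x `&` A = ((R' `|` L) `&` A) `|` ((cyl m x `\` (R' `|` L)) `&` A).
  rewrite -setIUl; congr (_ `&` _).
  by rewrite setDUK.
apply: measureU0; [| |].
- by apply: measurableI => //; exact: measurableU.
- by apply: measurableI => //; apply: measurableD => //; exact: measurableU.
- apply: (subset_measure0 (B := cyl m x `\` (R' `|` L))) => //.
    by apply: measurableI => //; apply: measurableD => //; exact: measurableU.
  by apply: measurableD => //; exact: measurableU.
Qed.

(** The Markov property at time [m], in a product form that covers null cylinders. The induction on
    [n] prolongs the path, hence ranges over all [m] and [x]. *)
Lemma prob_cyl_miss n m x :
  P (cyl m x `&` miss m n) = (P (cyl m x) * (avoid p q i n (x m))%:E)%E.
Proof.
elim: n m x => [|n IHn] m x.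
  rewrite mule1; congr (P _); apply/setIidPl => w _ k; lia.
rewrite split_step; last exact: measurable_miss.
(* A step to [i] makes the event empty; after any other step, [i] is already missed at time [m.+1]
   and the induction hypothesis applies from there. *)
have step y : P (cyl m.+1 (upd m x y) `&` miss m n.+1) =
    (P (cyl m x) * (bd_trans p q (x m) y *
                    (if y == i then 0 else avoid p q i n y))%:E)%E.
  case: eqVneq => [->|yi].
    rewrite mulr0 mule0 -[RHS](measure0 P); congr (P _).
    apply/seteqP; split=> w //=; rewrite cyl_upd => -[[_ /= h]] /(_ m.+1).
    by rewrite h; apply => //; lia.
  have -> : cyl m.+1 (upd m x y) `&` miss m n.+1 =
            cyl m.+1 (upd m x y) `&` miss m.+1 n.
    apply/seteqP; split=> w [cw mw]; split=> // k hk.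
      by apply: mw; lia.
    have [->|km] := eqVneq k m.+1.
      by move: cw; rewrite cyl_upd => -[_ /= ->]; exact/eqP.
    by apply: mw; lia.
  rewrite IHn prob_cyl_upd -muleA -EFinM; congr (_ * (_ * _)%:E)%E.
  by rewrite /upd eqxx.
rewrite !step bd_transR bd_transL -muleDr ?fin_num_measure//.
exact: measurable_cyl.
Qed.

Definition no_return : set Omega :=
  [set w | forall n : nat, (0 < n)%N -> X n w <> X 0%N w].

Lemma measurable_no_return : measurable no_return.
Proof.
(* Measurability comes from splitting [X n w = X 0 w] over the countably many common values [y]. *)
have -> : no_return =
   \bigcap_(n in [set n | (0 < n)%N]) \bigcap_y
     ~` ([set w | X n w = y] `&` [set w | X 0%N w = y]).
  apply/seteqP; split=> w /=.
    by move=> h n n0 y _ /= [] e1 e2; apply: (h n n0); rewrite e1 e2.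
  by move=> h n n0 e; apply: (h n n0 (X n w) I); split.
apply: bigcap_measurableType => // n _; apply: bigcap_measurableType => // y _.
by apply: measurableC; apply: measurableI; exact: measurable_eq.
Qed.

(** The chain almost surely starts at [i], so up to a null set [no_return] is the decreasing
    intersection of the events [miss 0 n]; continuity from above applies. *)
Lemma prob_no_return : avoid p q i ^~ i @ \oo --> fine (P no_return).
Proof.
have P0 : P (cyl 0 (fun=> i)) = 1%E.
  rewrite -X_chain.1; congr (P _); apply/seteqP; split=> w /=.
    by move=> /(_ 0%N (leqnn _)).
  by move=> h k; rewrite leqn0 => /eqP ->.
have mF n : measurable (cyl 0 (fun=> i) `&` miss 0 n).
  by apply: measurableI; [exact: measurable_cyl | exact: measurable_miss].
have bigE : \bigcap_n (cyl 0 (fun=> i) `&` miss 0 n) =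
    cyl 0 (fun=> i) `&` no_return.
  apply/seteqP; split=> w.
    move=> h; have [h0 _] := h 0%N I; split=> // n n0.
    by rewrite (h0 0%N)//; apply: (h n I).2; rewrite n0 add0n leqnn.
  move=> [h0 h] n _; split=> // k /andP[k0 _].
  by rewrite -(h0 0%N)//; exact: h.
have mret := measurable_no_return.
have PI A : measurable A -> P (cyl 0 (fun=> i) `&` A) = P A.
  move=> mA; have mC := measurable_cyl 0 (fun=> i).
  rewrite -[in RHS](setUIDK A (cyl 0 (fun=> i))) probU; last first.
  - by rewrite setDE setIACA setICr setI0.
  - exact: measurableD.
  - exact: measurableI.
  suff -> : P (A `\` cyl 0 (fun=> i)) = 0%E by rewrite adde0 setIC.
  apply: (subset_measure0 (B := ~` cyl 0 (fun=> i))).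
  - exact: measurableD.
  - exact: measurableC.
  - by move=> w [].
  - by apply: (etrans (probability_setC P mC)); rewrite P0 subee.
have Pcvg : P (cyl 0 (fun=> i) `&` miss 0 n) @[n --> \oo] --> P no_return.
  rewrite -PI// -bigE; apply: nonincreasing_cvg_mu => //.
  - by rewrite ltey_eq fin_num_measure.
  - exact: bigcap_measurableType.
  - move=> m n mn; apply/subsetPset => w [h0 h]; split=> // k hk.
    by apply: h; lia.
have -> : avoid p q i ^~ i = fine \o (fun n => P (cyl 0 (fun=> i) `&` miss 0 n)).
  by apply/funext => n /=; rewrite prob_cyl_miss P0 mul1e.
by apply: fine_cvg; rewrite fineK// fin_num_measure.
Qed.

Lemma transient_ratioP :
  transient_chain X <-> exists S, forall m, \sum_(k < m) ratio p q k <= S.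
Proof.
rewrite -(avoid_lim_gt0P p_gt0 q_gt0 pqD prob_no_return) /transient_chain.
have mN := measurable_no_return.
have -> : [set w | exists n : nat, (0 < n)%N /\ X n w = X 0%N w] = ~` no_return.
  apply/seteqP; split=> w /=; first by move=> [n [n0 e]] /(_ n n0).
  by move=> /existsNP[n] /not_implyP[n0 /contrapT e]; exists n.
rewrite [X in (X < _)%E](probability_setC P mN).
have /fineK <- : P no_return \is a fin_num by exact: fin_num_measure.
by rewrite -EFinB lte_fin gtrBl.
Qed.

End Chain.

(** * Square summability of [xi] and the series of ratios *)

Section Summability.
Context {R : realType}.

Lemma summable_bounded_series (u : nat -> R) (S : R) :
  (forall n, 0 <= u n) -> (forall m, \sum_(k < m) u k <= S) ->
  (\esum_(k in [set: nat]) (u k)%:E < +oo)%E.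
Proof.
move=> u_ge0 ubS; rewrite -nneseries_esumT; last by move=> n; rewrite lee_fin.
apply: (@le_lt_trans _ _ S%:E); last exact: ltry.
apply: lime_le; first by apply: is_cvg_nneseries => n _; rewrite lee_fin.
by apply: nearW => m; rewrite sumEFin lee_fin big_mkord.
Qed.

Lemma bounded_series_summable (T : choiceType) (h : nat -> T) (u : T -> R) :
  injective h -> (forall x, 0 <= u x) ->
  (\esum_(x in [set: T]) (u x)%:E < +oo)%E ->
  exists S, forall m, \sum_(k < m) u (h k) <= S.
Proof.
move=> h_inj u_ge0; set E := (\esum_(_ in _) _)%E => E_fin.
exists (fine E) => m; rewrite -lee_fin fineK; last first.
  by rewrite ge0_fin_numE//; apply: esum_ge0 => x _; rewrite lee_fin.
apply: esum_ge; exists (h @` `I_m).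
  by split=> //; apply: finite_image; exact: finite_II.
rewrite fsbig_image; last by move=> x y _ _; exact: h_inj.
by rewrite -fsbig_ord sumEFin.
Qed.

Lemma esum_arc (f : Defs.arc -> \bar R) : (forall a, 0 <= f a)%E ->
  (\esum_(a in [set: Defs.arc]) f a =
   \esum_(j in [set: nat]) f (arcR j) + \esum_(j in [set: nat]) f (arcL j))%E.
Proof.
move=> f_ge0; rewrite (esumID (range arcR))// !setTI.
have -> : ~` range arcR = range arcL.
  apply/seteqP; split=> [[j|j] /=|_ [j _ <-] [k _]//].
    by move=> /(_ (ex_intro2 _ _ j I erefl)).
  by move=> _; exists j.
by rewrite !esum_image// => x y _ _ [].
Qed.

Variables (eta : nat -> R[i]) (kappa : R).
Hypotheses (p_gt0 : forall j, 0 < pr eta kappa j)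
           (q_gt0 : forall j, 0 < qr eta kappa j).
Let r := ratio (pr eta kappa) (qr eta kappa).

Lemma xi_R_def j : xi_R eta kappa j = (-1) ^+ j.+1 * (Num.sqrt (r j))%:C.
Proof. by []. Qed.

Lemma Re_normCM (x y : R[i]) :
  complex.Re `|x * y| = complex.Re `|x| * complex.Re `|y|.
Proof. by rewrite normrM !normc_def /= mulr0 subr0. Qed.

Lemma sqr_norm_xi_R j : complex.Re `|xi_R eta kappa j| ^+ 2 = r j.
Proof.
rewrite xi_R_def Re_normCM normrX normrN1 expr1n mul1r normc_def /= expr0n/= addr0.
by rewrite sqrtr_sqr ger0_norm ?sqrtr_ge0// sqr_sqrtr// ratio_ge0.
Qed.

(** [xi] has squared modulus [r j] on both arcs of the edge from [j] to [j.+1] and 1 on the loop, so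
    its squared norm is 1 plus twice the series. *)
Lemma l2_scale_xiP (c : R[i]) : c != 0 ->
  l2 (c *: xi eta kappa) <-> exists S, forall m, \sum_(k < m) r k <= S.
Proof.
move=> c_neq0; set N := complex.Re `|c| ^+ 2.
have N_gt0 : 0 < N.
  rewrite exprn_even_gt0//=.
  by move: c_neq0; rewrite -normr_gt0 ltcE/= => /andP[_ /gt_eqF ->].
have NE a : complex.Re `|(c *: xi eta kappa) a| ^+ 2 =
            N * complex.Re `|xi eta kappa a| ^+ 2.
  by rewrite -exprMn -Re_normCM.
rewrite /l2 /summable.
have N_ge0 : 0 <= N by exact: ltW.
have -> : (\esum_(a in [set: Defs.arc])
              `|(complex.Re `|(c *: xi eta kappa) a| ^+ 2)%:E| =
           \esum_(a in [set: Defs.arc])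
              (N * complex.Re `|xi eta kappa a| ^+ 2)%:E)%E.
  by apply: eq_esum => a _; rewrite NE gee0_abs// lee_fin mulr_ge0 ?sqr_ge0.
split=> [fin|[S ubS]].
  have arcR_inj : injective arcR by move=> x y [].
  have [|S ubS] := bounded_series_summable arcR_inj _ fin.
    by move=> a; rewrite mulr_ge0 ?sqr_ge0.
  exists (S / N) => m; rewrite ler_pdivlMr// mulrC mulr_sumr.
  apply: le_trans (ubS m); apply: ler_sum => k _ /=.
  by rewrite sqr_norm_xi_R.
rewrite esum_arc; last by move=> a; rewrite lee_fin mulr_ge0 ?sqr_ge0.
apply: lte_add_pinfty.
  apply: (@summable_bounded_series _ (N * S)) => [n|m].
    by rewrite mulr_ge0 ?sqr_ge0.
  rewrite -mulr_sumr ler_pM2l//; apply: le_trans (ubS m).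
  by apply: ler_sum => k _; rewrite /= sqr_norm_xi_R.
(* The extra 1 is the self loop [arcL 0], which shifts the ratios by one index on the arcs
   [arcL]. *)
apply: (@summable_bounded_series _ (N * (1 + S))) => [n|m].
  by rewrite mulr_ge0 ?sqr_ge0.
have ge0 : 0 <= S by have := ubS 0%N; rewrite big_ord0.
rewrite -mulr_sumr ler_pM2l//; case: m => [|m].
  by rewrite big_ord0 addr_ge0.
rewrite big_ord_recl [X in X + _](_ : _ = 1); last first.
  by rewrite [xi _ _ _]/= normr1 /= expr1n.
rewrite lerD2l; apply: le_trans (ubS m).
by apply: ler_sum => k _; rewrite /= sqr_norm_xi_R.
Qed.

Lemma l2_0 : l2 (0 : Defs.arc -> R[i]).
Proof.
rewrite /l2 /summable esum1 ?ltry// => a _.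
by rewrite normr0 /= expr0n /= normr0.
Qed.

End Summability.

(** * Spectral decomposition of the coin and the eigenspace of the walk *)

Section Eigenspace.
Context {R : realType}.
Variables (eta : nat -> R[i]) (kappa : R).
Hypotheses (eta_le1 : forall j, `|eta j| <= 1)
           (eta_Im : forall j, complex.Im (eta j) = kappa)
           (kappa_neq : kappa != 1 /\ kappa != -1)
           (p_gt0 : forall j, 0 < pr eta kappa j)
           (q_gt0 : forall j, 0 < qr eta kappa j).
Let sinphi := Num.sqrt (1 - kappa ^+ 2).
Let lambda : R[i] := - 'i%C * expi (- acos kappa).
Let sqrtp j : R[i] := (Num.sqrt (pr eta kappa j))%:C.
Let sqrtq j : R[i] := (Num.sqrt (qr eta kappa j))%:C.

Lemma sqr_norm_eta_le1 j : complex.Re (eta j) ^+ 2 + kappa ^+ 2 <= 1.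
Proof.
rewrite -(eta_Im j) -lecR add_Re2_Im2.
exact: exprn_ile1 (normr_ge0 _) (eta_le1 j).
Qed.

Lemma sinphi_gt0 : 0 < sinphi.
Proof.
rewrite sqrtr_gt0 lt_neqAle; apply/andP; split; last first.
  have := sqr_norm_eta_le1 0; have := sqr_ge0 (complex.Re (eta 0)); lra.
case: kappa_neq => k1 k2.
have -> : 1 - kappa ^+ 2 = (1 - kappa) * (1 + kappa) by ring.
rewrite eq_sym mulf_neq0//; first by rewrite subr_eq0 eq_sym.
by rewrite addrC -[X in _ + X]opprK subr_eq0.
Qed.

Lemma sqr_sinphi : sinphi ^+ 2 = 1 - kappa ^+ 2.
Proof. by rewrite sqr_sqrtr// ltW// -sqrtr_gt0 sinphi_gt0. Qed.

Lemma prqrD j : pr eta kappa j + qr eta kappa j = 1.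
Proof. by rewrite /pr /qr; field; rewrite gt_eqF// sinphi_gt0. Qed.

Lemma eigvalE : lambda = (- sinphi) +i* (- kappa).
Proof.
have k1 : -1 <= kappa <= 1.
  have := sqr_norm_eta_le1 0; have := sqr_ge0 (complex.Re (eta 0)).
  by move=> ? ?; apply/andP; split; nra.
rewrite /lambda /expi cosN sinN sin_acos// acosK ?in_itv//= -/sinphi.
by apply/eqP; rewrite eq_complex /=; apply/andP; split; apply/eqP; ring.
Qed.

Lemma eigval_neq0 : lambda != 0.
Proof. by rewrite eigvalE eq_complex/= oppr_eq0 gt_eqF// sinphi_gt0. Qed.

Lemma sqr_sqrtp j : sqrtp j ^+ 2 = (pr eta kappa j)%:C.
Proof. by rewrite -rmorphXn/= sqr_sqrtr// ltW. Qed.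

Lemma sqr_sqrtq j : sqrtq j ^+ 2 = (qr eta kappa j)%:C.
Proof. by rewrite -rmorphXn/= sqr_sqrtr// ltW. Qed.

Lemma sqrtp_neq0 j : sqrtp j != 0.
Proof. by rewrite eq_complex/= eqxx andbT gt_eqF// sqrtr_gt0. Qed.

Lemma sqrtq_neq0 j : sqrtq j != 0.
Proof. by rewrite eq_complex/= eqxx andbT gt_eqF// sqrtr_gt0. Qed.

(** Both sides are nonnegative with square [sin^2 phi - Re(eta_j)^2], because
    [4 p_j q_j = 1 - Re(eta_j)^2 / sin^2 phi]. *)
Lemma rhoE j : (rho eta j)%:C = (2 * sinphi)%:C * sqrtp j * sqrtq j.
Proof.
rewrite -!rmorphM/=; congr (_%:C); rewrite /rho -mulrA -sqrtrM ?ltW//.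
have s0 := sinphi_gt0.
rewrite -[2 * sinphi]ger0_norm; last by lra.
rewrite -sqrtr_sqr -sqrtrM ?sqr_ge0//; congr Num.sqrt.
rewrite normc_def/= sqr_sqrtr ?addr_ge0 ?sqr_ge0// eta_Im.
rewrite /pr /qr -/sinphi exprMn.
have sn0 : sinphi != 0 by rewrite gt_eqF.
have -> : 2 ^+ 2 * sinphi ^+ 2 * (2^-1 * (1 - complex.Re (eta j) / sinphi) *
     (2^-1 * (1 + complex.Re (eta j) / sinphi))) =
    sinphi ^+ 2 - complex.Re (eta j) ^+ 2.
  by field.
by rewrite sqr_sinphi; ring.
Qed.

(** The factor [2 sin phi] is the gap between the eigenvalue [- i e^{i phi}] on the range of [K_j]
    and [lambda] on its orthogonal complement. *)
Lemma coin_arcR psi j : coin eta psi (arcR j) =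
  lambda * psi (arcR j) + (2 * sinphi)%:C * sqrtp j * Kadj eta kappa psi j.
Proof.
rewrite /= /Kadj -/(sqrtp j) -/(sqrtq j) rhoE.
suff -> : - eta j = lambda + (2 * sinphi)%:C * sqrtp j ^+ 2 by ring.
have -> : - eta j = (- complex.Re (eta j)) +i* (- kappa).
  by rewrite -(eta_Im j); case: (eta j).
rewrite sqr_sqrtp eigvalE -rmorphM/=.
apply/eqP; rewrite eq_complex /= addr0 eqxx andbT; apply/eqP.
by rewrite /pr -/sinphi; field; rewrite gt_eqF// sinphi_gt0.
Qed.

Lemma coin_arcL psi j : coin eta psi (arcL j) =
  lambda * psi (arcL j) + (2 * sinphi)%:C * sqrtq j * Kadj eta kappa psi j.
Proof.
rewrite /= /Kadj -/(sqrtp j) -/(sqrtq j) rhoE.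
suff -> : (eta j)^*%C = lambda + (2 * sinphi)%:C * sqrtq j ^+ 2 by ring.
have -> : (eta j)^*%C = complex.Re (eta j) +i* (- kappa).
  by rewrite -(eta_Im j); case: (eta j).
rewrite sqr_sqrtq eigvalE -rmorphM/=.
apply/eqP; rewrite eq_complex /= addr0 eqxx andbT; apply/eqP.
by rewrite /qr -/sinphi; field; rewrite gt_eqF// sinphi_gt0.
Qed.

Lemma walk_eigenP (psi : Defs.arc -> R[i]) :
  lambda *: psi - walk eta psi = 0 <->
  psi - Defs.shift psi = 0 /\ Kadj eta kappa psi = 0.
Proof.
split=> [/eqP|[/eqP + K0]]; rewrite subr_eq0 => /eqP e; last first.
  have {}K0 j : Kadj eta kappa psi j = 0 by rewrite K0.
  apply/eqP; rewrite subr_eq0; apply/eqP/funext => a.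
  have -> : (lambda *: psi) a = lambda * psi (arc_inv a) by rewrite {1}e.
  rewrite /walk /Defs.shift; case: (arc_inv a) => j.
    by rewrite coin_arcR K0 mulr0 addr0.
  by rewrite coin_arcL K0 mulr0 addr0.
have {}e a : lambda * psi a = coin eta psi (arc_inv a).
  by rewrite -[RHS]/(walk eta psi a) -e.
have s2q j : (2 * sinphi)%:C * sqrtq j != 0.
  rewrite mulf_neq0 ?sqrtq_neq0// eq_complex/= eqxx andbT.
  by rewrite mulf_neq0 ?pnatr_eq0// gt_eqF// sinphi_gt0.
(* Invariance at [arcL j] puts [lambda * psi (arcL j)] on both sides of the eigenvalue equation,
   leaving only the [Kadj] term. *)
have KL j : psi (arcL j) = psi (arc_inv (arcL j)) -> Kadj eta kappa psi j = 0.
  move=> h; have := e (arc_inv (arcL j)).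
  have -> : arc_inv (arc_inv (arcL j)) = arcL j by case: (j).
  rewrite -h coin_arcL -{1}[lambda * _]addr0 => /addrI /esym/eqP.
  by rewrite mulf_eq0 (negbTE (s2q j)) => /eqP.
have RL j : Kadj eta kappa psi j = 0 -> psi (arcL j.+1) = psi (arcR j).
  move=> Kj; have := e (arcL j.+1).
  by rewrite [arc_inv _]/= coin_arcR Kj mulr0 addr0 => /(mulfI eigval_neq0).
(* The self loop is its own inverse, so the premise of [KL] is trivial at 0; [RL] supplies it at
   each next vertex. *)
have K j : Kadj eta kappa psi j = 0.
  by elim: j => [|j IHj]; apply: KL => //; exact: RL.
split; last exact/funext.
apply/eqP; rewrite subr_eq0; apply/eqP/funext => -[j|[|j]] //=; last exact: RL.
by apply/esym/RL.
Qed.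

(** The alternating sign opposes the two terms at each vertex; their moduli agree by [ratioS], and
    at 0 by the value 1 on the loop. *)
Lemma Kadj_xi : Kadj eta kappa (xi eta kappa) = 0.
Proof.
apply/funext => j; rewrite /Kadj -/(sqrtp j) -/(sqrtq j).
have r_ge0 k : 0 <= ratio (pr eta kappa) (qr eta kappa) k by exact: ratio_ge0.
case: j => [|j]; rewrite /= !xi_R_def /sqrtp /sqrtq.
  rewrite expr1 mulN1r mulrN mulr1 -rmorphM/= -sqrtrM ?ltW//.
  rewrite /ratio !big_ord1 mulrCA divff ?gt_eqF// mulr1 addNr//.
rewrite [in X in X + _]exprS mulN1r mulNr mulrN !(mulrCA _ ((-1) ^+ _)).
rewrite -!rmorphM/= -!sqrtrM ?ltW// ratioS//.
by rewrite addNr.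
Qed.

Lemma shift_xi : Defs.shift (xi eta kappa) = xi eta kappa.
Proof. by apply/funext => -[j|[|j]]. Qed.

(** The value on the loop determines [psi]: [Kadj] at [j] leads from [arcL j] to [arcR j], and the
    shift from [arcR j] to [arcL j.+1]. [xi] obeys the same recursion with value 1 on the loop. *)
Lemma shift_Kadj_eq_xi (psi : Defs.arc -> R[i]) :
  psi - Defs.shift psi = 0 -> Kadj eta kappa psi = 0 ->
  psi = psi (arcL 0) *: xi eta kappa.
Proof.
move=> /eqP; rewrite subr_eq0 => /eqP Spsi Kpsi.
have LR j : psi (arcL j.+1) = psi (arcR j) by rewrite {1}Spsi.
have K0 (f : Defs.arc -> R[i]) j : Kadj eta kappa f = 0 ->
    f (arcR j) = - (sqrtq j / sqrtp j) * f (arcL j).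
  move=> /(congr1 (@^~ j)); rewrite /Kadj -/(sqrtp j) -/(sqrtq j) /= => /eqP.
  rewrite addr_eq0 => /eqP h; apply: (mulfI (sqrtp_neq0 j)); rewrite h.
  by field; rewrite sqrtp_neq0.
have Rj j : psi (arcR j) = psi (arcL 0) * xi eta kappa (arcR j).
  elim: j => [|j IHj]; rewrite (K0 psi _ Kpsi) (K0 (xi eta kappa) _ Kadj_xi).
    by rewrite /= mulr1 mulrC.
  by rewrite LR IHj /=; ring.
by apply/funext => -[j|[|j]]; rewrite ?LR ?Rj//= -[LHS]mulr1.
Qed.

Lemma Hplus_neq0P : Hplus eta kappa <> [set 0] <-> l2 (xi eta kappa).
Proof.
have H0 : Hplus eta kappa 0.
  split; split; try exact: l2_0.
    by rewrite sub0r; apply/eqP; rewrite oppr_eq0.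
  by apply/funext => j; rewrite /Kadj !mulr0 addr0.
split=> [H_neq0|xi_l2 H0E].
  have [psi [Hpsi psi_neq0]] : exists psi, Hplus eta kappa psi /\ psi <> 0.
    apply: contrapT => /forallNP h; apply: H_neq0; apply/seteqP.
    split=> [psi Hpsi|_ ->//].
    by apply: contrapT => psi0; apply: (h psi).
  have [[psi_l2 Spsi] [_ Kpsi]] := Hpsi.
  have psiE := shift_Kadj_eq_xi Spsi Kpsi.
  have c_neq0 : psi (arcL 0) != 0.
    by apply/eqP => c0; apply: psi_neq0; rewrite psiE c0 scale0r.
  move: psi_l2; rewrite psiE => /(l2_scale_xiP p_gt0 q_gt0 c_neq0).
  by move=> /(l2_scale_xiP p_gt0 q_gt0 (oner_neq0 _)); rewrite scale1r.
have : Hplus eta kappa (xi eta kappa).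
  by split; split=> //; [rewrite shift_xi subrr | exact: Kadj_xi].
rewrite H0E => /(congr1 (@^~ (arcL 0))) /eqP; exact/negP/oner_neq0.
Qed.

End Eigenspace.

Theorem proposition3p2 (R : realType) (eta : nat -> R[i]) (kappa : R)
  (heta : forall j : nat, `|eta j| <= 1)
  (hkappa : forall j : nat, complex.Im (eta j) = kappa)
  (hcoin : kappa != 1 /\ kappa != -1)
  (hp : forall j : nat, 0 < pr eta kappa j)
  (hq : forall j : nat, 0 < qr eta kappa j) :
  (forall (i : nat) (d : measure_display) (Omega : measurableType d)
          (P : probability Omega R) (X : nat -> {RV P >-> nat}),
      bd_chain (pr eta kappa) (qr eta kappa) i X ->
      (transient_chain X <-> Hplus eta kappa <> [set 0])) /\
  Hplus eta kappa =
    ker_l2 (fun psi => (- 'i%C * expi (- acos kappa)) *: psi - walk eta psi) /\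
  (Hplus eta kappa <> [set 0] ->
   Hplus eta kappa = range (fun c : R[i] => c *: xi eta kappa)).
Proof.
have pqD := prqrD heta hkappa hcoin.
have xiP := l2_scale_xiP hp hq.
have HP := Hplus_neq0P hp hq.
split; last split.
- move=> i d Omega P X X_chain.
  (* Both sides reduce to boundedness of the partial sums of the ratios. *)
  rewrite (transient_ratioP hp hq pqD X_chain) HP -(xiP 1) ?oner_neq0//.
  by rewrite scale1r.
- have eigP := walk_eigenP heta hkappa hcoin hp hq.
  apply/seteqP; split=> psi.
    by move=> [[psi_l2 Spsi] [_ Kpsi]]; split=> //; apply/eigP.
  by move=> [psi_l2 /eigP[Spsi Kpsi]]; split; split.
- move=> /HP xi_l2; apply/seteqP; split=> [psi [[_ Spsi] [_ Kpsi]]|_ [c _ <-]].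
    by exists (psi (arcL 0)) => //; rewrite -(shift_Kadj_eq_xi hp hq Spsi Kpsi).
  have cl2 : l2 (c *: xi eta kappa).
    have [->|c0] := eqVneq c 0; first by rewrite scale0r; exact: l2_0.
    by apply/(xiP _ c0)/(xiP _ (oner_neq0 _)); rewrite scale1r.
  split; split=> //.
    by apply/eqP; rewrite subr_eq0; apply/eqP/funext => -[j|[|j]].
  apply/funext => j; have := congr1 (@^~ j) (Kadj_xi hp hq).
  rewrite /Kadj /= => K0; rewrite !(mulrCA _ c) -mulrDr.
  by rewrite [X in c * X]K0 mulr0.
Qed.
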